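(* Let $X$ and $Y$ be independent generalised random variables on $\mathbb{R}$ with pairs $(T_1,\varphi_1)$ and $(T_2,\varphi_2)$, and let $Z=X+Y$. Then the weak characteristic function of $Z$ factorises: for all $t\in\mathbb{R}$, $${}^{(\varphi)}\phi_Z(t)={}^{(\varphi_1)}\phi_1(t)\;{}^{(\varphi_2)}\phi_2(t).$$
   Context: $\mathcal{S}$, $\mathcal{S}'$ denote Schwartz functions and tempered distributions. A generalised random variable on $\mathbb{R}$ is specified by a pair $(T,\varphi)$, $T\in\mathcal{S}'(\mathbb{R})$, $\varphi\in\mathcal{S}(\mathbb{R})$; its weak characteristic function is ${}^{(\varphi)}\phi(t):=\langle T,e^{itx}\varphi(x)\rangle$. Write ${}^{(\varphi_j)}\phi_j(t)=\langle T_j,e^{itx}\varphi_j(x)\rangle$, $j=1,2$. $X$ and $Y$ with pairs $(T_1,\varphi_1)$, $(T_2,\varphi_2)$ are independent if their joint representation is the tensor product pair $(T_1\otimes T_2,\varphi_1\otimes\varphi_2)$ on $\mathbb{R}^2$. The weak characteristic function of the sum is then ${}^{(\varphi)}\phi_Z(t):=\langle T_1\otimes T_2,\;e^{it(x+y)}\varphi_1(x)\varphi_2(y)\rangle$. *)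

(* Defs.v *)
From Stdlib Require Import Reals Lra Lia ProofIrrelevance FunctionalExtensionality.
From Coquelicot Require Import Coquelicot.
Open Scope R_scope.

(* Coquelicot's total derivatives are real-valued, so derivatives of
   complex-valued functions are taken on real and imaginary parts. *)
Definition Csmooth (f : R -> C) : Prop :=
  forall n x, ex_derive_n (fun u => Re (f u)) n x
           /\ ex_derive_n (fun u => Im (f u)) n x.

Definition Cderive_n (f : R -> C) (n : nat) (x : R) : C :=
  (Derive_n (fun u => Re (f u)) n x, Derive_n (fun u => Im (f u)) n x).

Definition Csmooth2 (F : R -> R -> C) : Prop :=
  forall n x y, ex_diff_n (fun u v => Re (F u v)) n x y
             /\ ex_diff_n (fun u v => Im (F u v)) n x y.

(* [m] derivatives in the first variable, [n] in the second. *)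
Definition Cpartial_derive (m n : nat) (F : R -> R -> C) (x y : R) : C :=
  (partial_derive m n (fun u v => Re (F u v)) x y,
   partial_derive m n (fun u v => Im (F u v)) x y).

Definition seminorm (k n : nat) (f : R -> C) : Rbar :=
  Lub_Rbar (fun r => exists x, r = Rabs x ^ k * Cmod (Cderive_n f n x)).

Definition is_schwartz (f : R -> C) : Prop :=
  Csmooth f /\ forall k n, Rbar_lt (seminorm k n f) p_infty.

Record schwartz := Schwartz {
  schwartz_fun :> R -> C;
  schwartzP : is_schwartz schwartz_fun }.

Definition seminorm2 (j k m n : nat) (F : R -> R -> C) : Rbar :=
  Lub_Rbar (fun r => exists x y,
    r = Rabs x ^ j * Rabs y ^ k * Cmod (Cpartial_derive m n F x y)).

Definition is_schwartz2 (F : R -> R -> C) : Prop :=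
  Csmooth2 F /\ forall j k m n, Rbar_lt (seminorm2 j k m n F) p_infty.

Record schwartz2 := Schwartz2 {
  schwartz2_fun :> R -> R -> C;
  schwartz2P : is_schwartz2 schwartz2_fun }.

Lemma schwartz_ext (f g : schwartz) : (forall x, f x = g x) -> f = g.
Proof.
  destruct f as [f Hf], g as [g Hg]; simpl; intros H.
  apply functional_extensionality in H; subst g.
  f_equal; apply proof_irrelevance.
Qed.

Lemma schwartz2_ext (F G : schwartz2) : (forall x y, F x y = G x y) -> F = G.
Proof.
  destruct F as [F HF], G as [G HG]; simpl; intros H.
  assert (E : F = G) by (do 2 (apply functional_extensionality; intro); apply H).
  subst G; f_equal; apply proof_irrelevance.
Qed.

Definition Cis_derive (f : R -> C) (x : R) (l : C) : Prop :=
  is_derive (fun u => Re (f u)) x (Re l) /\ is_derive (fun u => Im (f u)) x (Im l).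

Definition Ccontinuity_2d_pt (F : R -> R -> C) (x y : R) : Prop :=
  continuity_2d_pt (fun u v => Re (F u v)) x y
  /\ continuity_2d_pt (fun u v => Im (F u v)) x y.

Definition is_jet (f : R -> C) (D : nat -> R -> C) : Prop :=
  (forall x, D 0%nat x = f x) /\ forall n x, Cis_derive (D n) x (D (S n) x).

Definition is_jet2 (F : R -> R -> C) (D : nat -> nat -> R -> R -> C) : Prop :=
  (forall x y, D 0%nat 0%nat x y = F x y) /\
  forall m n x y, Ccontinuity_2d_pt (D m n) x y
    /\ Cis_derive (fun u => D m n u y) x (D (S m) n x y)
    /\ Cis_derive (fun v => D m n x v) y (D m (S n) x y).

Lemma Derive_n_family (d : nat -> R -> R) :
  (forall n x, is_derive (d n) x (d (S n) x)) ->
  forall n, Derive_n (d 0%nat) n = d n.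
Proof.
  intros H; induction n as [|n IH]; [reflexivity|].
  apply functional_extensionality; intro x; simpl; rewrite IH.
  apply is_derive_unique, H.
Qed.

Lemma ex_derive_n_family (d : nat -> R -> R) :
  (forall n x, is_derive (d n) x (d (S n) x)) ->
  forall n x, ex_derive_n (d 0%nat) n x.
Proof.
  intros H [|n] x; [exact I|]; simpl; rewrite (Derive_n_family d H).
  eexists; apply H.
Qed.

Lemma jet_smooth f D : is_jet f D -> Csmooth f.
Proof.
  intros [H0 H] n x; replace f with (D 0%nat) by
    (apply functional_extensionality; exact H0).
  split.
  - apply (ex_derive_n_family (fun n x => Re (D n x))); intros; apply H.
  - apply (ex_derive_n_family (fun n x => Im (D n x))); intros; apply H.
Qed.

Lemma jet_derive f D : is_jet f D -> forall n x, Cderive_n f n x = D n x.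
Proof.
  intros [H0 H] n x; replace f with (D 0%nat) by
    (apply functional_extensionality; exact H0).
  unfold Cderive_n.
  rewrite (Derive_n_family (fun n x => Re (D n x))) by (intros; apply H).
  rewrite (Derive_n_family (fun n x => Im (D n x))) by (intros; apply H).
  destruct (D n x); reflexivity.
Qed.

Lemma smooth_jet f : Csmooth f -> is_jet f (Cderive_n f).
Proof.
  intros H; split.
  - intro x; unfold Cderive_n; simpl; destruct (f x); reflexivity.
  - intros n x; destruct (H (S n) x) as [H1 H2].
    split; unfold Cderive_n; simpl; apply Derive_correct; assumption.
Qed.

Section RealFamily2.
Variable d : nat -> nat -> R -> R -> R.
Hypothesis dx : forall m n x y, is_derive (fun u => d m n u y) x (d (S m) n x y).
Hypothesis dy : forall m n x y, is_derive (fun v => d m n x v) y (d m (S n) x y).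
Hypothesis dc : forall m n x y, continuity_2d_pt (d m n) x y.

Lemma ex_diff_n_family N : forall m n x y, ex_diff_n (d m n) N x y.
Proof.
  induction N as [|N IH]; intros m n x y; simpl; split; try apply dc; try exact I.
  repeat split.
  - eexists; apply dx.
  - eexists; apply dy.
  - apply ex_diff_n_ext_loc with (2 := IH (S m) n x y).
    apply locally_2d_forall; intros; symmetry; apply is_derive_unique, dx.
  - apply ex_diff_n_ext_loc with (2 := IH m (S n) x y).
    apply locally_2d_forall; intros; symmetry; apply is_derive_unique, dy.
Qed.

Lemma partial_derive_family m n x y : partial_derive m n (d 0%nat 0%nat) x y = d m n x y.
Proof.
  unfold partial_derive.
  replace (fun t => Derive_n (fun z => d 0 0 t z) n y) with (fun t => d 0 n t y).
  - rewrite (Derive_n_family (fun k t => d k n t y)) by (intros; apply dx).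
    reflexivity.
  - apply functional_extensionality; intro t.
    pose proof (Derive_n_family (fun k z => d 0 k t z)%nat) as H.
    change (fun z => d 0 0 t z) with ((fun k z => d 0%nat k t z) 0%nat).
    rewrite H by (intros; apply dy); reflexivity.
Qed.
End RealFamily2.

Lemma jet2_smooth F D : is_jet2 F D -> Csmooth2 F.
Proof.
  intros [H0 H] n x y; replace F with (D 0%nat 0%nat) by
    (do 2 (apply functional_extensionality; intro); apply H0).
  split.
  - apply (ex_diff_n_family (fun m n x y => Re (D m n x y))); intros; apply H.
  - apply (ex_diff_n_family (fun m n x y => Im (D m n x y))); intros; apply H.
Qed.

Lemma jet2_derive F D : is_jet2 F D ->
  forall m n x y, Cpartial_derive m n F x y = D m n x y.
Proof.
  intros [H0 H] m n x y; replace F with (D 0%nat 0%nat) by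
    (do 2 (apply functional_extensionality; intro); apply H0).
  unfold Cpartial_derive.
  rewrite (partial_derive_family (fun m n x y => Re (D m n x y))) by (intros; apply H).
  rewrite (partial_derive_family (fun m n x y => Im (D m n x y))) by (intros; apply H).
  destruct (D m n x y); reflexivity.
Qed.

Lemma smooth2_jet F : Csmooth2 F -> is_jet2 F (fun m n => Cpartial_derive m n F).
Proof.
  intros H; split.
  - intros x y; unfold Cpartial_derive, partial_derive; simpl.
    destruct (F x y); reflexivity.
  - assert (A : forall f : R -> R -> R, (forall n x y, ex_diff_n f n x y) ->
      forall m n x y, continuity_2d_pt (partial_derive m n f) x y
        /\ is_derive (fun u => partial_derive m n f u y) x (partial_derive (S m) n f x y)
        /\ is_derive (fun v => partial_derive m n f x v) y (partial_derive m (S n) f x y)).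
    { intros f Hf m n x y; split; [|split].
      - pose proof (ex_diff_n_deriv (m + n) m n (Nat.le_refl _) f x y (Hf _ _ _)) as E.
        rewrite Nat.sub_diag in E; exact (proj1 E).
      - change (partial_derive (S m) n f x y)
          with (Derive (fun u => partial_derive m n f u y) x).
        apply Derive_correct.
        apply ex_diff_n_ex_deriv_inf_1 with (n := S (m + n)); [lia|apply Hf].
      - rewrite <- Derive_partial_derive by (apply locally_2d_forall; intros; apply Hf).
        apply Derive_correct.
        apply ex_diff_n_ex_deriv_inf_2 with (n := S (m + n)); [lia|apply Hf]. }
    intros m n x y.
    destruct (A _ (fun n x y => proj1 (H n x y)) m n x y) as (a & b & c).
    destruct (A _ (fun n x y => proj2 (H n x y)) m n x y) as (a' & b' & c').
    split; [|split]; split; assumption.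
Qed.

Lemma seminorm_le k n f (M : R) :
  Rbar_le (seminorm k n f) M <-> forall x, Rabs x ^ k * Cmod (Cderive_n f n x) <= M.
Proof.
  unfold seminorm; match goal with |- context [Lub_Rbar ?E] =>
    destruct (Lub_Rbar_correct E) as [Hub Hlub] end.
  split.
  - intros H x; change (Rbar_le (Rabs x ^ k * Cmod (Cderive_n f n x)) M).
    eapply Rbar_le_trans; [apply Hub; eexists; reflexivity|exact H].
  - intros H; apply Hlub; intros r [x ->]; apply H.
Qed.

Lemma seminorm2_le j k m n F (M : R) :
  Rbar_le (seminorm2 j k m n F) M <->
  forall x y, Rabs x ^ j * Rabs y ^ k * Cmod (Cpartial_derive m n F x y) <= M.
Proof.
  unfold seminorm2; match goal with |- context [Lub_Rbar ?E] =>
    destruct (Lub_Rbar_correct E) as [Hub Hlub] end.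
  split.
  - intros H x y.
    change (Rbar_le (Rabs x ^ j * Rabs y ^ k * Cmod (Cpartial_derive m n F x y)) M).
    eapply Rbar_le_trans; [apply Hub; do 2 eexists; reflexivity|exact H].
  - intros H; apply Hlub; intros r (x & y & ->); apply H.
Qed.

Lemma Rbar_lt_infty_le (a : Rbar) : Rbar_lt a p_infty <-> exists M : R, Rbar_le a M.
Proof.
  split; destruct a as [a| |]; simpl; try easy.
  - intros _; exists a; apply Rle_refl.
  - exists 0; exact I.
  - intros [? []].
Qed.

Lemma jet_schwartz f D : is_jet f D ->
  (forall k n, exists M, forall x, Rabs x ^ k * Cmod (D n x) <= M) -> is_schwartz f.
Proof.
  intros J B; split; [apply (jet_smooth _ _ J)|]; intros k n.
  apply Rbar_lt_infty_le; destruct (B k n) as [M HM]; exists M.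
  apply seminorm_le; intro x; rewrite (jet_derive _ _ J); apply HM.
Qed.

Lemma jet2_schwartz2 F D : is_jet2 F D ->
  (forall j k m n, exists M, forall x y, Rabs x ^ j * Rabs y ^ k * Cmod (D m n x y) <= M) ->
  is_schwartz2 F.
Proof.
  intros J B; split; [apply (jet2_smooth _ _ J)|]; intros j k m n.
  apply Rbar_lt_infty_le; destruct (B j k m n) as [M HM]; exists M.
  apply seminorm2_le; intros x y; rewrite (jet2_derive _ _ J); apply HM.
Qed.

Lemma schwartz_jet (f : schwartz) : is_jet f (Cderive_n f).
Proof. apply smooth_jet, schwartzP. Qed.

Lemma schwartz_bound (f : schwartz) k n :
  exists M, forall x, Rabs x ^ k * Cmod (Cderive_n f n x) <= M.
Proof.
  destruct (proj1 (Rbar_lt_infty_le _) (proj2 (schwartzP f) k n)) as [M HM].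
  exists M; apply seminorm_le, HM.
Qed.

Lemma schwartz2_jet (F : schwartz2) : is_jet2 F (fun m n => Cpartial_derive m n F).
Proof. apply smooth2_jet, schwartz2P. Qed.

Lemma schwartz2_bound (F : schwartz2) j k m n :
  exists M, forall x y, Rabs x ^ j * Rabs y ^ k * Cmod (Cpartial_derive m n F x y) <= M.
Proof.
  destruct (proj1 (Rbar_lt_infty_le _) (proj2 (schwartz2P F) j k m n)) as [M HM].
  exists M; apply seminorm2_le, HM.
Qed.

Lemma Cis_derive_plus f g x a b :
  Cis_derive f x a -> Cis_derive g x b ->
  Cis_derive (fun u => f u + g u)%C x (a + b)%C.
Proof.
  intros [H1 H2] [H3 H4]; split.
  - exact (is_derive_plus _ _ _ _ _ H1 H3).
  - exact (is_derive_plus _ _ _ _ _ H2 H4).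
Qed.

Lemma Cis_derive_mult f g x a b :
  Cis_derive f x a -> Cis_derive g x b ->
  Cis_derive (fun u => f u * g u)%C x (a * g x + f x * b)%C.
Proof.
  assert (M : forall p q : R -> R, forall a b, is_derive p x a -> is_derive q x b ->
    is_derive (fun u => p u * q u) x (a * q x + p x * b)).
  { intros p q a0 b0 Hp Hq; apply (is_derive_mult p q x a0 b0 Hp Hq).
    intros; apply Rmult_comm. }
  intros [H1 H2] [H3 H4]; split.
  - pose proof (is_derive_minus _ _ _ _ _ (M _ _ _ _ H1 H3) (M _ _ _ _ H2 H4)) as E.
    eapply (is_derive_ext (fun u => Re (f u) * Re (g u) - Im (f u) * Im (g u)));
      [reflexivity|].
    replace (Re _) with (Re a * Re (g x) + Re (f x) * Re b -
      (Im a * Im (g x) + Im (f x) * Im b)) by (unfold Re, Im; simpl; ring).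
    exact E.
  - pose proof (is_derive_plus _ _ _ _ _ (M _ _ _ _ H1 H4) (M _ _ _ _ H2 H3)) as E.
    eapply (is_derive_ext (fun u => Re (f u) * Im (g u) + Im (f u) * Re (g u)));
      [reflexivity|].
    replace (Im _) with (Re a * Im (g x) + Re (f x) * Im b +
      (Im a * Re (g x) + Im (f x) * Re b)) by (unfold Re, Im; simpl; ring).
    exact E.
Qed.

Lemma Cis_derive_const c x : Cis_derive (fun _ => c) x 0%C.
Proof. split; simpl; apply (is_derive_const (K := R_AbsRing) (V := R_NormedModule)). Qed.

Lemma Cis_derive_eq f x a b : Cis_derive f x a -> a = b -> Cis_derive f x b.
Proof. intros H <-; exact H. Qed.

Lemma Ccontinuity_plus F G x y :
  Ccontinuity_2d_pt F x y -> Ccontinuity_2d_pt G x y ->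
  Ccontinuity_2d_pt (fun u v => F u v + G u v)%C x y.
Proof.
  intros [H1 H2] [H3 H4]; split.
  - exact (continuity_2d_pt_plus _ _ _ _ H1 H3).
  - exact (continuity_2d_pt_plus _ _ _ _ H2 H4).
Qed.

Lemma Ccontinuity_mult F G x y :
  Ccontinuity_2d_pt F x y -> Ccontinuity_2d_pt G x y ->
  Ccontinuity_2d_pt (fun u v => F u v * G u v)%C x y.
Proof.
  intros [H1 H2] [H3 H4]; split.
  - exact (continuity_2d_pt_minus _ _ _ _
      (continuity_2d_pt_mult _ _ _ _ H1 H3) (continuity_2d_pt_mult _ _ _ _ H2 H4)).
  - exact (continuity_2d_pt_plus _ _ _ _
      (continuity_2d_pt_mult _ _ _ _ H1 H4) (continuity_2d_pt_mult _ _ _ _ H2 H3)).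
Qed.

Lemma Ccontinuity_const c x y : Ccontinuity_2d_pt (fun _ _ => c) x y.
Proof. split; apply continuity_2d_pt_const. Qed.

Lemma weighted_plus w a b M N : 0 <= w ->
  w * Cmod a <= M -> w * Cmod b <= N -> w * Cmod (a + b)%C <= M + N.
Proof. intros Hw H1 H2; pose proof (Cmod_triangle a b); nra. Qed.

Lemma weighted_scal w c a M :
  w * Cmod a <= M -> w * Cmod (c * a)%C <= Cmod c * M.
Proof. intros H; rewrite Cmod_mult; pose proof (Cmod_ge_0 c); nra. Qed.

Lemma weight_ge_0 x k : 0 <= Rabs x ^ k.
Proof. apply pow_le, Rabs_pos. Qed.

Lemma weight2_ge_0 x y j k : 0 <= Rabs x ^ j * Rabs y ^ k.
Proof. apply Rmult_le_pos; apply weight_ge_0. Qed.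

Lemma plus_jet (f g : schwartz) :
  is_jet (fun x => f x + g x)%C (fun n x => Cderive_n f n x + Cderive_n g n x)%C.
Proof.
  destruct (schwartz_jet f) as [F0 F], (schwartz_jet g) as [G0 G]; split.
  - intro x; rewrite F0, G0; reflexivity.
  - intros n x; apply Cis_derive_plus; auto.
Qed.

Lemma is_schwartz_plus (f g : schwartz) : is_schwartz (fun x => f x + g x)%C.
Proof.
  apply (jet_schwartz _ _ (plus_jet f g)); intros k n.
  destruct (schwartz_bound f k n) as [M HM], (schwartz_bound g k n) as [N HN].
  exists (M + N); intro x; apply weighted_plus; auto using weight_ge_0.
Qed.

Lemma scal_jet c (f : schwartz) :
  is_jet (fun x => c * f x)%C (fun n x => c * Cderive_n f n x)%C.
Proof.
  destruct (schwartz_jet f) as [F0 F]; split.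
  - intro x; rewrite F0; reflexivity.
  - intros n x; eapply Cis_derive_eq.
    + apply Cis_derive_mult; [apply Cis_derive_const|apply F].
    + cbv beta; ring.
Qed.

Lemma is_schwartz_scal c (f : schwartz) : is_schwartz (fun x => c * f x)%C.
Proof.
  apply (jet_schwartz _ _ (scal_jet c f)); intros k n.
  destruct (schwartz_bound f k n) as [M HM].
  exists (Cmod c * M); intro x; apply weighted_scal; auto.
Qed.

Definition splus (f g : schwartz) : schwartz := Schwartz _ (is_schwartz_plus f g).
Definition sscal (c : C) (f : schwartz) : schwartz := Schwartz _ (is_schwartz_scal c f).

Lemma derive_splus f g n x :
  Cderive_n (splus f g) n x = (Cderive_n f n x + Cderive_n g n x)%C.
Proof. exact (jet_derive _ _ (plus_jet f g) n x). Qed.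

Lemma derive_sscal c f n x : Cderive_n (sscal c f) n x = (c * Cderive_n f n x)%C.
Proof. exact (jet_derive _ _ (scal_jet c f) n x). Qed.

Lemma plus2_jet (F G : schwartz2) :
  is_jet2 (fun x y => F x y + G x y)%C
    (fun m n x y => Cpartial_derive m n F x y + Cpartial_derive m n G x y)%C.
Proof.
  destruct (schwartz2_jet F) as [F0 HF], (schwartz2_jet G) as [G0 HG]; split.
  - intros x y; rewrite F0, G0; reflexivity.
  - intros m n x y; destruct (HF m n x y) as (a & b & c), (HG m n x y) as (a' & b' & c').
    split; [|split]; [apply Ccontinuity_plus|apply Cis_derive_plus|apply Cis_derive_plus];
      assumption.
Qed.

Lemma is_schwartz2_plus (F G : schwartz2) : is_schwartz2 (fun x y => F x y + G x y)%C.
Proof.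
  apply (jet2_schwartz2 _ _ (plus2_jet F G)); intros j k m n.
  destruct (schwartz2_bound F j k m n) as [M HM], (schwartz2_bound G j k m n) as [N HN].
  exists (M + N); intros x y; apply weighted_plus; auto using weight2_ge_0.
Qed.

Lemma scal2_jet c (F : schwartz2) :
  is_jet2 (fun x y => c * F x y)%C (fun m n x y => c * Cpartial_derive m n F x y)%C.
Proof.
  destruct (schwartz2_jet F) as [F0 HF]; split.
  - intros x y; rewrite F0; reflexivity.
  - intros m n x y; destruct (HF m n x y) as (a & b & d).
    split; [|split].
    + apply Ccontinuity_mult; [apply Ccontinuity_const|assumption].
    + eapply Cis_derive_eq;
        [apply Cis_derive_mult; [apply Cis_derive_const|exact b]|cbv beta; ring].
    + eapply Cis_derive_eq;
        [apply Cis_derive_mult; [apply Cis_derive_const|exact d]|cbv beta; ring].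
Qed.

Lemma is_schwartz2_scal c (F : schwartz2) : is_schwartz2 (fun x y => c * F x y)%C.
Proof.
  apply (jet2_schwartz2 _ _ (scal2_jet c F)); intros j k m n.
  destruct (schwartz2_bound F j k m n) as [M HM].
  exists (Cmod c * M); intros x y; apply weighted_scal; auto.
Qed.

Definition splus2 (F G : schwartz2) : schwartz2 := Schwartz2 _ (is_schwartz2_plus F G).
Definition sscal2 (c : C) (F : schwartz2) : schwartz2 := Schwartz2 _ (is_schwartz2_scal c F).

Lemma partial_splus2 F G m n x y : Cpartial_derive m n (splus2 F G) x y
  = (Cpartial_derive m n F x y + Cpartial_derive m n G x y)%C.
Proof. exact (jet2_derive _ _ (plus2_jet F G) m n x y). Qed.

Lemma partial_sscal2 c F m n x y :
  Cpartial_derive m n (sscal2 c F) x y = (c * Cpartial_derive m n F x y)%C.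
Proof. exact (jet2_derive _ _ (scal2_jet c F) m n x y). Qed.

(* Continuity is for the locally convex topology generated by the seminorms:
   the sets of [g] with [seminorm k n (g - f) < delta] for all [k, n <= N]
   form a neighbourhood basis of [f]. *)
Record tempered := Tempered {
  tempered_fun :> schwartz -> C;
  tempered_plus : forall f g, tempered_fun (splus f g) = (tempered_fun f + tempered_fun g)%C;
  tempered_scal : forall c f, tempered_fun (sscal c f) = (c * tempered_fun f)%C;
  tempered_cont : forall (f : schwartz) (eps : posreal),
    exists (N : nat) (delta : posreal), forall g : schwartz,
      (forall k n, (k <= N)%nat -> (n <= N)%nat ->
         Rbar_lt (seminorm k n (fun x => g x - f x)%C) delta) ->
      Cmod (tempered_fun g - tempered_fun f) < eps }.

Record tempered2 := Tempered2 {
  tempered2_fun :> schwartz2 -> C;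
  tempered2_plus : forall F G,
    tempered2_fun (splus2 F G) = (tempered2_fun F + tempered2_fun G)%C;
  tempered2_scal : forall c F, tempered2_fun (sscal2 c F) = (c * tempered2_fun F)%C;
  tempered2_cont : forall (F : schwartz2) (eps : posreal),
    exists (N : nat) (delta : posreal), forall G : schwartz2,
      (forall j k m n, (j <= N)%nat -> (k <= N)%nat -> (m <= N)%nat -> (n <= N)%nat ->
         Rbar_lt (seminorm2 j k m n (fun x y => G x y - F x y)%C) delta) ->
      Cmod (tempered2_fun G - tempered2_fun F) < eps }.

Lemma tempered_bounded (T : tempered) :
  exists (N : nat) (K : R), 0 < K /\ forall (f : schwartz) (M : R), 0 < M ->
    (forall k n x, (k <= N)%nat -> (n <= N)%nat ->
       Rabs x ^ k * Cmod (Cderive_n f n x) <= M) ->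
    Cmod (T f) <= K * M.
Proof.
  assert (Z : is_schwartz (fun _ => 0%C)).
  { apply (jet_schwartz _ (fun _ _ => 0%C)).
    - split; [reflexivity|]; intros; apply Cis_derive_const.
    - intros; exists 0; intro; rewrite Cmod_0; lra. }
  set (z := Schwartz _ Z).
  assert (Tz : T z = 0%C).
  { replace z with (sscal 0 z).
    - rewrite tempered_scal; ring.
    - apply schwartz_ext; intro; simpl; ring. }
  destruct (tempered_cont T z (mkposreal 1 Rlt_0_1)) as (N & delta & H).
  pose proof (cond_pos delta) as Hd.
  exists N, (2 / delta); split; [apply Rdiv_lt_0_compat; lra|].
  intros f M HM B.
  set (c := delta / (2 * M)).
  assert (Hc : 0 < c) by (apply Rdiv_lt_0_compat; lra).
  specialize (H (sscal (RtoC c) f)).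
  rewrite Tz, tempered_scal in H; simpl in H.
  assert (L : Cmod (c * T f - 0)%C < 1).
  { apply H; intros k n Hk Hn.
    apply Rbar_le_lt_trans with (Finite (delta / 2)); [|simpl; lra].
    apply seminorm_le; intro x.
    replace (fun x => c * f x - 0)%C with (fun x => c * f x)%C
      by (apply functional_extensionality; intro; ring).
    rewrite (jet_derive _ _ (scal_jet c f)).
    eapply Rle_trans; [apply weighted_scal, B; assumption|].
    rewrite Cmod_R, Rabs_pos_eq by lra; unfold c; right; field; lra. }
  replace (c * T f - 0)%C with (c * T f)%C in L by ring.
  rewrite Cmod_mult, Cmod_R, Rabs_pos_eq in L by lra.
  replace (2 / delta * M) with (/ c) by (unfold c; field; lra).
  apply Rmult_le_reg_l with c; [exact Hc|].
  rewrite Rinv_r by lra; lra.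
Qed.

Lemma slice_jet (F : schwartz2) x : is_jet (F x) (fun n y => Cpartial_derive 0 n F x y).
Proof.
  destruct (schwartz2_jet F) as [F0 HF]; split; [intro; apply F0|].
  intros n y; apply HF.
Qed.

Lemma is_schwartz_slice (F : schwartz2) x : is_schwartz (F x).
Proof.
  apply (jet_schwartz _ _ (slice_jet F x)); intros k n.
  destruct (schwartz2_bound F 0 k 0 n) as [M HM]; exists M; intro y.
  specialize (HM x y); rewrite pow_O, Rmult_1_l in HM; exact HM.
Qed.

Definition slice (F : schwartz2) (x : R) : schwartz := Schwartz _ (is_schwartz_slice F x).

Lemma derive_slice F x n y : Cderive_n (slice F x) n y = Cpartial_derive 0 n F x y.
Proof. exact (jet_derive _ _ (slice_jet F x) n y). Qed.

Lemma partial_jet (F : schwartz2) p q :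
  is_jet2 (Cpartial_derive p q F) (fun m n => Cpartial_derive (m + p) (n + q) F).
Proof.
  destruct (schwartz2_jet F) as [F0 HF]; split; [reflexivity|].
  intros m n x y; apply (HF (m + p)%nat (n + q)%nat).
Qed.

Lemma is_schwartz2_partial (F : schwartz2) p q : is_schwartz2 (Cpartial_derive p q F).
Proof.
  apply (jet2_schwartz2 _ _ (partial_jet F p q)); intros; apply schwartz2_bound.
Qed.

Definition spartial (p q : nat) (F : schwartz2) : schwartz2 :=
  Schwartz2 _ (is_schwartz2_partial F p q).

Lemma partial_spartial p q F m n x y :
  Cpartial_derive m n (spartial p q F) x y = Cpartial_derive (m + p) (n + q) F x y.
Proof. exact (jet2_derive _ _ (partial_jet F p q) m n x y). Qed.

Lemma bounded_upto (P : nat -> nat -> R -> Prop) N :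
  (forall k n M M', M <= M' -> P k n M -> P k n M') ->
  (forall k n, exists M, P k n M) ->
  exists M, 0 < M /\ forall k n, (k <= N)%nat -> (n <= N)%nat -> P k n M.
Proof.
  intros mono ex.
  assert (A : forall (Q : nat -> R -> Prop),
    (forall k M M', M <= M' -> Q k M -> Q k M') -> (forall k, exists M, Q k M) ->
    exists M, 0 < M /\ forall k, (k <= N)%nat -> Q k M).
  { intros Q mQ eQ; induction N as [|N' IH].
    - destruct (eQ 0%nat) as [M HM]; exists (Rmax 1 M); split.
      + pose proof (Rmax_l 1 M); lra.
      + intros k Hk; replace k with 0%nat by lia.
        apply mQ with M; auto; apply Rmax_r.
    - destruct IH as (M0 & HM0 & H0), (eQ (S N')) as [M HM].
      exists (Rmax M0 M); split.
      + pose proof (Rmax_l M0 M); lra.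
      + intros k Hk; destruct (Nat.eq_dec k (S N')) as [->|Hne].
        * apply mQ with M; auto; apply Rmax_r.
        * apply mQ with M0; [apply Rmax_l|apply H0; lia]. }
  destruct (A (fun k M => forall n, (n <= N)%nat -> P k n M)) as (M & HM & H).
  - intros k M M' L H n Hn; apply mono with M; auto.
  - intro k; destruct (A (P k)) as (M & _ & H); [apply mono|apply ex|].
    exists M; exact H.
  - exists M; split; auto.
Qed.

Lemma second_order (f f1 f2 : R -> R) B :
  (forall x, is_derive f x (f1 x)) -> (forall x, is_derive f1 x (f2 x)) ->
  forall x h, (forall c, Rabs (f2 c) <= B) -> Rabs (f (x + h) - f x - h * f1 x) <= B * h ^ 2.
Proof.
  intros H1 H2 x h HB.
  destruct (MVT_cor4 f f1 x (Rabs h) (fun c _ => H1 c) (x + h)) as (c & E & Hc).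
  { right; f_equal; ring. }
  destruct (MVT_cor4 f1 f2 x (Rabs h) (fun c _ => H2 c) c) as (d & E' & Hd).
  { replace (x + h - x) with h in Hc by ring; exact Hc. }
  replace (x + h - x) with h in * by ring.
  rewrite E; replace (f1 c * h - h * f1 x) with ((f1 c - f1 x) * h) by ring.
  rewrite E', !Rabs_mult, <- (pow2_abs h).
  specialize (HB d); pose proof (Rabs_pos h); pose proof (Rabs_pos (c - x));
    pose proof (Rabs_pos (f2 d)).
  assert (Rabs (f2 d) * Rabs (c - x) <= B * Rabs h) by nra.
  nra.
Qed.

Lemma Cmod_le_sum (z : C) : Cmod z <= Rabs (Re z) + Rabs (Im z).
Proof.
  replace z with (RtoC (Re z) + Ci * RtoC (Im z))%C
    by (destruct z; unfold Ci, RtoC, Re, Im, Cmult, Cplus; simpl; f_equal; ring).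
  eapply Rle_trans; [apply Cmod_triangle|].
  rewrite Cmod_mult, !Cmod_R.
  replace (Cmod Ci) with 1
    by (unfold Cmod, Ci; simpl; replace (0 * (0 * 1) + 1 * (1 * 1)) with 1 by ring;
        rewrite sqrt_1; reflexivity).
  destruct z; unfold Ci, RtoC, Re, Im, Cmult, Cplus; simpl.
  right; f_equal; [f_equal|rewrite Rmult_1_l; f_equal]; ring.
Qed.

Lemma im_le_Cmod (z : C) : Rabs (Im z) <= Cmod z.
Proof. eapply Rle_trans; [apply Rmax_r|apply Rmax_Cmod]. Qed.

Lemma second_orderC (f f1 f2 : R -> C) B :
  (forall x, Cis_derive f x (f1 x)) -> (forall x, Cis_derive f1 x (f2 x)) ->
  forall x h, (forall c, Cmod (f2 c) <= B) ->
  Cmod (f (x + h)%R - f x - h * f1 x)%C <= 2 * B * h ^ 2.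
Proof.
  intros H1 H2 x h HB; eapply Rle_trans; [apply Cmod_le_sum|].
  pose proof (second_order (fun u => Re (f u)) (fun u => Re (f1 u)) (fun u => Re (f2 u)) B
    (fun x => proj1 (H1 x)) (fun x => proj1 (H2 x)) x h
    (fun c => Rle_trans _ _ _ (re_le_Cmod _) (HB c))) as A.
  pose proof (second_order (fun u => Im (f u)) (fun u => Im (f1 u)) (fun u => Im (f2 u)) B
    (fun x => proj2 (H1 x)) (fun x => proj2 (H2 x)) x h
    (fun c => Rle_trans _ _ _ (im_le_Cmod _) (HB c))) as A'.
  replace (Re (f (x + h)%R - f x - h * f1 x)%C)
    with (Re (f (x + h)) - Re (f x) - h * Re (f1 x)) by (unfold Re; simpl; ring).
  replace (Im (f (x + h)%R - f x - h * f1 x)%C)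
    with (Im (f (x + h)) - Im (f x) - h * Im (f1 x)) by (unfold Im; simpl; ring).
  lra.
Qed.

Lemma quadratic_is_derive (g : R -> R) x l K :
  (forall h, Rabs (g (x + h) - g x - h * l) <= K * h ^ 2) -> is_derive g x l.
Proof.
  intros H; apply is_derive_Reals; intros eps Heps.
  assert (HK : 0 < Rabs K + 1) by (pose proof (Rabs_pos K); lra).
  exists (mkposreal (eps / (Rabs K + 1)) (Rdiv_lt_0_compat _ _ Heps HK)).
  intros h Hh Hlt; simpl in Hlt.
  replace ((g (x + h) - g x) / h - l) with ((g (x + h) - g x - h * l) / h)
    by (field; assumption).
  pose proof (Rabs_pos_lt h Hh) as Hp.
  unfold Rdiv; rewrite Rabs_mult, Rabs_inv.
  apply Rmult_lt_reg_r with (Rabs h); [exact Hp|].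
  rewrite Rmult_assoc, Rinv_l, Rmult_1_r by lra.
  apply Rle_lt_trans with (1 := H h); rewrite <- (pow2_abs h).
  apply (Rmult_lt_compat_r (Rabs K + 1)) in Hlt; [|exact HK].
  unfold Rdiv in Hlt; rewrite Rmult_assoc, Rinv_l, Rmult_1_r in Hlt by lra.
  pose proof (Rle_abs K); nra.
Qed.

Lemma pair_derive (T : tempered) (F : schwartz2) x :
  Cis_derive (fun u => T (slice F u)) x (T (slice (spartial 1 0 F) x)).
Proof.
  destruct (tempered_bounded T) as (N & K & HK & HT).
  destruct (bounded_upto (fun k n M => forall u y,
     Rabs y ^ k * Cmod (Cpartial_derive 2 n F u y) <= M) N) as (M & HM & B).
  { intros k n M M' L H u y; eapply Rle_trans; [apply H|exact L]. }
  { intros k n; destruct (schwartz2_bound F 0 k 2 n) as [M HM]; exists M; intros u y.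
    specialize (HM u y); rewrite pow_O, Rmult_1_l in HM; exact HM. }
  assert (Q : forall h, Cmod (T (slice F (x + h)) - T (slice F x)
     - h * T (slice (spartial 1 0 F) x))%C <= 2 * K * M * h ^ 2).
  { intro h; destruct (Req_dec h 0) as [->|Hh].
    { rewrite Rplus_0_r.
      replace (_ - _ - _)%C with (RtoC 0) by ring.
      rewrite Cmod_0; simpl; lra. }
    set (w := splus (slice F (x + h)) (splus (sscal (-1)%R (slice F x))
                (sscal (- h)%R (slice (spartial 1 0 F) x)))).
    replace (_ - _ - _)%C with (T w).
    2:{ unfold w; rewrite !tempered_plus, !tempered_scal, !RtoC_opp; ring. }
    assert (Hh2 : 0 < h ^ 2) by (apply pow2_gt_0; exact Hh).
    replace (2 * K * M * h ^ 2) with (K * (2 * M * h ^ 2)) by ring.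
    apply HT; [apply Rmult_lt_0_compat; lra|].
    intros k n y Hk Hn; unfold w.
    rewrite !derive_splus, !derive_sscal, !derive_slice, partial_spartial.
    rewrite Nat.add_0_r, Nat.add_0_l.
    replace (_ + _)%C with (Cpartial_derive 0 n F (x + h) y - Cpartial_derive 0 n F x y
      - h * Cpartial_derive 1 n F x y)%C by (rewrite !RtoC_opp; ring).
    destruct (schwartz2_jet F) as [_ J].
    pose proof (weight_ge_0 y k) as Hw.
    destruct (Req_dec (Rabs y ^ k) 0) as [E|E].
    { rewrite E, Rmult_0_l; apply Rmult_le_pos; lra. }
    assert (Hw' : 0 < Rabs y ^ k) by lra.
    pose proof (second_orderC (fun u => Cpartial_derive 0 n F u y)
      (fun u => Cpartial_derive 1 n F u y) (fun u => Cpartial_derive 2 n F u y)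
      (M / Rabs y ^ k)) as S.
    apply Rle_trans with (Rabs y ^ k * (2 * (M / Rabs y ^ k) * h ^ 2)).
    2:{ right; field; exact E. }
    apply Rmult_le_compat_l; [exact Hw|].
    apply S; try (intros; apply J).
    intro c; apply Rmult_le_reg_l with (Rabs y ^ k); [exact Hw'|].
    replace (Rabs y ^ k * (M / Rabs y ^ k)) with M by (field; exact E).
    apply B; assumption. }
  split; apply quadratic_is_derive with (2 * K * M); intro h;
    (eapply Rle_trans; [|apply (Q h)]).
  - eapply Rle_trans; [|apply re_le_Cmod].
    right; f_equal; unfold Re; simpl; ring.
  - eapply Rle_trans; [|apply im_le_Cmod].
    right; f_equal; unfold Im; simpl; ring.
Qed.

Lemma pair_jet (T : tempered) (F : schwartz2) :
  is_jet (fun x => T (slice F x)) (fun m x => T (slice (spartial m 0 F) x)).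
Proof.
  split.
  - intro x; f_equal; apply schwartz_ext; intro y; simpl.
    apply (proj1 (schwartz2_jet F)).
  - intros m x; eapply Cis_derive_eq; [apply pair_derive|].
    f_equal; apply schwartz_ext; intro y; simpl.
    apply (jet2_derive _ _ (partial_jet F m 0) 1 0).
Qed.

Lemma pair_bound (T : tempered) : exists N K, 0 < K /\
  forall (F : schwartz2) k m M, 0 < M ->
    (forall k' n x y, (k' <= N)%nat -> (n <= N)%nat ->
       Rabs x ^ k * Rabs y ^ k' * Cmod (Cpartial_derive m n F x y) <= M) ->
    forall x, Rabs x ^ k * Cmod (T (slice (spartial m 0 F) x)) <= K * M.
Proof.
  destruct (tempered_bounded T) as (N & K & HK & HT).
  exists N, K; split; [exact HK|]; intros F k m M HM B x.
  set (c := Rabs x ^ k).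
  assert (Hc : 0 <= c) by apply weight_ge_0.
  replace (c * Cmod (T (slice (spartial m 0 F) x)))
    with (Cmod (T (sscal c (slice (spartial m 0 F) x))))
    by (rewrite tempered_scal, Cmod_mult, Cmod_R, (Rabs_pos_eq c) by exact Hc; reflexivity).
  apply HT; [exact HM|]; intros k' n y Hk Hn.
  rewrite derive_sscal, derive_slice, partial_spartial, Nat.add_0_r, Nat.add_0_l.
  rewrite Cmod_mult, Cmod_R, (Rabs_pos_eq c) by exact Hc.
  specialize (B k' n x y Hk Hn); fold c in B; nra.
Qed.

Lemma is_schwartz_pair (T : tempered) (F : schwartz2) : is_schwartz (fun x => T (slice F x)).
Proof.
  apply (jet_schwartz _ _ (pair_jet T F)); intros k m.
  destruct (pair_bound T) as (N & K & HK & HP).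
  destruct (bounded_upto (fun k' n M => forall x y,
     Rabs x ^ k * Rabs y ^ k' * Cmod (Cpartial_derive m n F x y) <= M) N) as (M & HM & B).
  { intros k' n M M' L H u y; eapply Rle_trans; [apply H|exact L]. }
  { intros k' n; apply schwartz2_bound. }
  exists (K * M); apply HP; auto.
Qed.

Definition partial_pair (T : tempered) (F : schwartz2) : schwartz :=
  Schwartz _ (is_schwartz_pair T F).

Lemma partial_pair_plus T F G :
  partial_pair T (splus2 F G) = splus (partial_pair T F) (partial_pair T G).
Proof.
  apply schwartz_ext; intro x; simpl; rewrite <- tempered_plus.
  f_equal; apply schwartz_ext; reflexivity.
Qed.

Lemma partial_pair_scal T c F :
  partial_pair T (sscal2 c F) = sscal c (partial_pair T F).
Proof.
  apply schwartz_ext; intro x; simpl; rewrite <- tempered_scal.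
  f_equal; apply schwartz_ext; reflexivity.
Qed.

Section Tensor.
Variables T1 T2 : tempered.

Lemma tensor_plus F G : T1 (partial_pair T2 (splus2 F G))
  = (T1 (partial_pair T2 F) + T1 (partial_pair T2 G))%C.
Proof. rewrite partial_pair_plus; apply tempered_plus. Qed.

Lemma tensor_scal c F : T1 (partial_pair T2 (sscal2 c F)) = (c * T1 (partial_pair T2 F))%C.
Proof. rewrite partial_pair_scal; apply tempered_scal. Qed.

Lemma tensor_cont (F : schwartz2) (eps : posreal) :
  exists (N : nat) (delta : posreal), forall G : schwartz2,
    (forall j k m n, (j <= N)%nat -> (k <= N)%nat -> (m <= N)%nat -> (n <= N)%nat ->
       Rbar_lt (seminorm2 j k m n (fun x y => G x y - F x y)%C) delta) ->
    Cmod (T1 (partial_pair T2 G) - T1 (partial_pair T2 F)) < eps.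
Proof.
  destruct (tempered_bounded T1) as (N1 & K1 & HK1 & H1).
  destruct (pair_bound T2) as (N2 & K2 & HK2 & H2).
  pose proof (cond_pos eps) as He.
  assert (HK : 0 < K1 * K2) by nra.
  assert (Hd : 0 < eps / (2 * (K1 * K2))) by (apply Rdiv_lt_0_compat; lra).
  exists (N1 + N2)%nat, (mkposreal _ Hd); intros G HG; simpl in HG.
  set (d := eps / (2 * (K1 * K2))) in *.
  set (W := splus2 G (sscal2 (-1)%R F)).
  replace (T1 (partial_pair T2 G) - T1 (partial_pair T2 F))%C with (T1 (partial_pair T2 W))
    by (unfold W; rewrite tensor_plus, tensor_scal; ring).
  apply Rle_lt_trans with (K1 * (K2 * d)).
  2:{ replace (K1 * (K2 * d)) with (eps / 2) by (unfold d; field; lra); lra. }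
  apply H1; [apply Rmult_lt_0_compat; assumption|].
  intros k m x Hk Hm; simpl.
  rewrite (jet_derive _ _ (pair_jet T2 W)).
  apply H2; [exact Hd|]; intros k' n u v Hk' Hn; revert u v.
  apply seminorm2_le, Rbar_lt_le.
  replace (schwartz2_fun W) with (fun x y => G x y - F x y)%C.
  - apply HG; lia.
  - do 2 (apply functional_extensionality; intro); simpl; ring.
Qed.

(* <T1 (x) T2, F> = <T1(x), <T2(y), F(x, y)>>. *)
Definition tensor : tempered2 :=
  Tempered2 (fun F => T1 (partial_pair T2 F)) tensor_plus tensor_scal tensor_cont.
End Tensor.

Lemma Ccontinuity_proj1 (f : R -> C) l x y :
  Cis_derive f x l -> Ccontinuity_2d_pt (fun u _ => f u) x y.
Proof.
  intros [H1 H2]; split.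
  - apply (continuity_1d_2d_pt_comp (fun u => Re (f u)) (fun u _ => u));
      [|apply continuity_2d_pt_id1].
    apply derivable_continuous_pt; eexists; apply is_derive_Reals, H1.
  - apply (continuity_1d_2d_pt_comp (fun u => Im (f u)) (fun u _ => u));
      [|apply continuity_2d_pt_id1].
    apply derivable_continuous_pt; eexists; apply is_derive_Reals, H2.
Qed.

Lemma Ccontinuity_proj2 (f : R -> C) l x y :
  Cis_derive f y l -> Ccontinuity_2d_pt (fun _ v => f v) x y.
Proof.
  intros [H1 H2]; split.
  - apply (continuity_1d_2d_pt_comp (fun u => Re (f u)) (fun _ v => v));
      [|apply continuity_2d_pt_id2].
    apply derivable_continuous_pt; eexists; apply is_derive_Reals, H1.
  - apply (continuity_1d_2d_pt_comp (fun u => Im (f u)) (fun _ v => v));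
      [|apply continuity_2d_pt_id2].
    apply derivable_continuous_pt; eexists; apply is_derive_Reals, H2.
Qed.

Lemma is_schwartz2_tensor (f g : schwartz) : is_schwartz2 (fun x y => f x * g y)%C.
Proof.
  destruct (schwartz_jet f) as [F0 F], (schwartz_jet g) as [G0 G].
  apply (jet2_schwartz2 _ (fun m n x y => Cderive_n f m x * Cderive_n g n y)%C).
  - split; [intros; rewrite F0, G0; reflexivity|].
    intros m n x y; split; [|split].
    + apply Ccontinuity_mult; [eapply Ccontinuity_proj1|eapply Ccontinuity_proj2]; auto.
    + eapply Cis_derive_eq;
        [apply Cis_derive_mult; [apply F|apply Cis_derive_const]|cbv beta; ring].
    + eapply Cis_derive_eq;
        [apply Cis_derive_mult; [apply Cis_derive_const|apply G]|cbv beta; ring].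
  - intros j k m n.
    destruct (schwartz_bound f j m) as [M HM], (schwartz_bound g k n) as [M' HM'].
    exists (M * M'); intros x y; rewrite Cmod_mult.
    replace (_ * _) with ((Rabs x ^ j * Cmod (Cderive_n f m x)) *
      (Rabs y ^ k * Cmod (Cderive_n g n y))) by ring.
    apply Rmult_le_compat; auto using Rmult_le_pos, weight_ge_0, Cmod_ge_0.
Qed.

Definition stensor (f g : schwartz) : schwartz2 := Schwartz2 _ (is_schwartz2_tensor f g).

Definition Cexpi (a : R) : C := (cos a, sin a).

Lemma Cmod_Cexpi a : Cmod (Cexpi a) = 1.
Proof.
  unfold Cmod, Cexpi; cbn [fst snd].
  rewrite <- !Rsqr_pow2, Rplus_comm, sin2_cos2; apply sqrt_1.
Qed.

Lemma Cis_derive_expi (t b x : R) :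
  Cis_derive (fun u => Cexpi (t * (u + b))) x ((0, t) * Cexpi (t * (x + b)))%C.
Proof.
  split; unfold Re, Im, Cexpi; simpl.
  - auto_derive; [trivial|ring].
  - auto_derive; [trivial|ring].
Qed.

Lemma is_schwartz_derive (f : schwartz) : is_schwartz (Cderive_n f 1).
Proof.
  apply (jet_schwartz _ (fun n => Cderive_n f (S n))).
  - split; [reflexivity|]; intros; apply schwartz_jet.
  - intros; apply schwartz_bound.
Qed.

Definition sderive (f : schwartz) : schwartz := Schwartz _ (is_schwartz_derive f).

(* f |-> i t f + f', the derivative conjugated by the character. *)
Definition twist (t : R) (f : schwartz) : schwartz := splus (sscal (0, t) f) (sderive f).

Lemma is_schwartz_char (t : R) (f : schwartz) : is_schwartz (fun x => Cexpi (t * x) * f x)%C.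
Proof.
  apply (jet_schwartz _ (fun n x => Cexpi (t * x) * Nat.iter n (twist t) f x)%C).
  - split; [reflexivity|]; intros n x.
    eapply Cis_derive_eq.
    + apply Cis_derive_mult.
      * pose proof (Cis_derive_expi t 0 x) as E; rewrite Rplus_0_r in E.
        replace (fun u => Cexpi (t * u)) with (fun u => Cexpi (t * (u + 0)))
          by (apply functional_extensionality; intro; rewrite Rplus_0_r; reflexivity).
        exact E.
      * pose proof (proj2 (schwartz_jet (Nat.iter n (twist t) f)) 0%nat x) as E.
        replace (Cderive_n (Nat.iter n (twist t) f) 0)
          with (schwartz_fun (Nat.iter n (twist t) f)) in E
          by (apply functional_extensionality; intro; symmetry; apply schwartz_jet).
        exact E.
    + simpl; ring.
  - intros k n; destruct (schwartz_bound (Nat.iter n (twist t) f) k 0) as [M HM].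
    exists M; intro x; rewrite Cmod_mult, Cmod_Cexpi, Rmult_1_l.
    specialize (HM x); rewrite (proj1 (schwartz_jet _)) in HM; exact HM.
Qed.

Definition schar (t : R) (f : schwartz) : schwartz := Schwartz _ (is_schwartz_char t f).

Definition twist1 (t : R) (F : schwartz2) : schwartz2 :=
  splus2 (sscal2 (0, t) F) (spartial 1 0 F).
Definition twist2 (t : R) (F : schwartz2) : schwartz2 :=
  splus2 (sscal2 (0, t) F) (spartial 0 1 F).

Lemma twist_comm t F : twist2 t (twist1 t F) = twist1 t (twist2 t F).
Proof.
  apply schwartz2_ext; intros x y.
  change (((0, t) * twist1 t F x y + Cpartial_derive 0 1 (twist1 t F) x y)%C
    = ((0, t) * twist2 t F x y + Cpartial_derive 1 0 (twist2 t F) x y)%C).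
  unfold twist1, twist2; rewrite !partial_splus2, !partial_sscal2, !partial_spartial.
  simpl; ring.
Qed.

Lemma twist_comm_iter t m F :
  twist2 t (Nat.iter m (twist1 t) F) = Nat.iter m (twist1 t) (twist2 t F).
Proof.
  induction m as [|m IH]; [reflexivity|]; simpl; rewrite twist_comm, IH; reflexivity.
Qed.

Lemma is_schwartz2_char (t : R) (F : schwartz2) :
  is_schwartz2 (fun x y => Cexpi (t * (x + y)) * F x y)%C.
Proof.
  set (G := fun m n => Nat.iter m (twist1 t) (Nat.iter n (twist2 t) F)).
  assert (J0 : forall H : schwartz2, (fun x y => Cpartial_derive 0 0 H x y) = H).
  { intro H; do 2 (apply functional_extensionality; intro).
    apply (proj1 (schwartz2_jet H)). }
  apply (jet2_schwartz2 _ (fun m n x y => Cexpi (t * (x + y)) * G m n x y)%C).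
  - split; [reflexivity|]; intros m n x y.
    destruct (proj2 (schwartz2_jet (G m n)) 0%nat 0%nat x y) as (a & b & c).
    change (Cpartial_derive 0 0 (G m n)) with
      (fun x y => Cpartial_derive 0 0 (G m n) x y) in a, b, c.
    rewrite J0 in a, b, c.
    split; [|split].
    + apply Ccontinuity_mult; [|exact a].
      assert (L : continuity_2d_pt (fun u v => t * (u + v)) x y).
      { apply continuity_2d_pt_mult; [apply continuity_2d_pt_const|].
        apply continuity_2d_pt_plus;
          [apply continuity_2d_pt_id1|apply continuity_2d_pt_id2]. }
      split.
      * apply (continuity_1d_2d_pt_comp cos (fun u v => t * (u + v)));
          [apply continuity_cos|exact L].
      * apply (continuity_1d_2d_pt_comp sin (fun u v => t * (u + v)));
          [apply continuity_sin|exact L].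
    + eapply Cis_derive_eq; [apply Cis_derive_mult; [apply Cis_derive_expi|exact b]|].
      unfold G; simpl; ring.
    + eapply Cis_derive_eq; [apply Cis_derive_mult; [|exact c]|].
      * pose proof (Cis_derive_expi t x y) as E.
        replace (fun v => Cexpi (t * (x + v))) with (fun v => Cexpi (t * (v + x)))
          by (apply functional_extensionality; intro; rewrite Rplus_comm; reflexivity).
        exact E.
      * replace (G m (S n)) with (twist2 t (G m n)) by apply twist_comm_iter.
        rewrite (Rplus_comm y x); simpl; ring.
  - intros j k m n; destruct (schwartz2_bound (G m n) j k 0 0) as [M HM].
    exists M; intros x y; rewrite Cmod_mult, Cmod_Cexpi, Rmult_1_l.
    specialize (HM x y); rewrite (proj1 (schwartz2_jet _)) in HM; exact HM.
Qed.

Definition schar2 (t : R) (F : schwartz2) : schwartz2 := Schwartz2 _ (is_schwartz2_char t F).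

Record gen_rv := GenRV { rv_dist : tempered; rv_test : schwartz }.

Record gen_rv2 := GenRV2 { rv2_dist : tempered2; rv2_test : schwartz2 }.

Definition weak_cf (X : gen_rv) (t : R) : C := rv_dist X (schar t (rv_test X)).

(* [XY] is the joint representation of [X] and [Y]. *)
Definition independent (X Y : gen_rv) (XY : gen_rv2) : Prop :=
  XY = GenRV2 (tensor (rv_dist X) (rv_dist Y)) (stensor (rv_test X) (rv_test Y)).

(* The weak characteristic function of the sum of the two components of a
   jointly represented pair. *)
Definition weak_cf_sum (XY : gen_rv2) (t : R) : C := rv2_dist XY (schar2 t (rv2_test XY)).

(* Main.v *)
Require Import Defs.
From Stdlib Require Import Reals.
From Coquelicot Require Import Coquelicot.

(** The character splits, $e^{it(x+y)} = e^{itx}e^{ity}$, so multiplying $\varphi_1\otimes\varphi_2$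
    by it gives an elementary tensor again ([schar2_stensor]). On elementary tensors $T_1\otimes
    T_2$ is the product of the two pairings ([tensor_stensor]). *)

Lemma Cexpi_plus (a b : R) : Cexpi (a + b) = (Cexpi a * Cexpi b)%C.
Proof.
  unfold Cexpi, Cmult; simpl; rewrite cos_plus, sin_plus; f_equal; ring.
Qed.

Lemma schar2_stensor (t : R) (f g : schwartz) :
  schar2 t (stensor f g) = stensor (schar t f) (schar t g).
Proof.
  apply schwartz2_ext; intros x y; simpl.
  rewrite Rmult_plus_distr_l, Cexpi_plus; ring.
Qed.

(** For fixed $x$ the slice of $f\otimes g$ is the multiple $f(x)\,g$, and linearity of [T] takes
    the scalar $f(x)$ out. The outer distribution then meets only a constant times [f]. *)
Lemma partial_pair_stensor (T : tempered) (f g : schwartz) :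
  partial_pair T (stensor f g) = sscal (T g) f.
Proof.
  apply schwartz_ext; intro x; simpl.
  rewrite Cmult_comm, <- tempered_scal.
  f_equal; apply schwartz_ext; reflexivity.
Qed.

Lemma tensor_stensor (S T : tempered) (f g : schwartz) :
  tensor S T (stensor f g) = (S f * T g)%C.
Proof.
  simpl; rewrite partial_pair_stensor, tempered_scal; apply Cmult_comm.
Qed.

Theorem proposition3p4 (X Y : gen_rv) (XY : gen_rv2) (hXY : independent X Y XY) :
  forall t : R, weak_cf_sum XY t = (weak_cf X t * weak_cf Y t)%C.
Proof.
  intro t; rewrite hXY; unfold weak_cf_sum, weak_cf; cbn [rv2_dist rv2_test].
  rewrite schar2_stensor; apply tensor_stensor.
Qed.
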